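(* Let $m\ge 1$ be an integer, let $K$ be a simplicial complex with a fixed vertex $v_0$, and let $1\le r<s$ be integers. For each $r$-tuple $1\le i_1<\cdots<i_r\le s$ define $\mathcal{I}_{(i_1,\dots,i_r)}:K^r\to K^s$ by $\mathcal{I}_{(i_1,\dots,i_r)}(\sigma_1,\dots,\sigma_r)=(\varphi_1,\dots,\varphi_s)$, where $$\varphi_k=\begin{cases}\sigma_l & \text{if } k=i_l,\\ v_0 & \text{otherwise.}\end{cases}$$ Denote the elements of the set $\{\mathcal{I}_{(i_1,\dots,i_r)}\mid 1\le i_1<\cdots<i_r\le s\}$ by $\mathcal{I}_1,\dots,\mathcal{I}_{\binom{s}{r}}$. Then $$\mathrm{SD}_m\bigl(\mathcal{I}_1,\mathcal{I}_2,\dots,\mathcal{I}_{\binom{s}{r}}\bigr)=\mathrm{scat}_m(K^r).$$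
   Context: Simplicial complexes are abstract simplicial complexes; the complex $K$ is assumed edge-path connected (any two vertices are joined by a finite chain of edges). Subcomplexes used in coverings and the test complexes $P$ below need not be connected. Two simplicial maps $\varphi,\psi:A\to B$ are contiguous, $\varphi\sim_c\psi$, if for every simplex $\{v_0,\dots,v_k\}$ of $A$ the set $\{\varphi(v_0),\dots,\varphi(v_k),\psi(v_0),\dots,\psi(v_k)\}$ is a simplex of $B$. They are in the same contiguity class, $\varphi\sim\psi$, if there is a finite sequence of simplicial maps $A\to B$ starting at $\varphi$ and ending at $\psi$ in which consecutive maps are contiguous. For simplicial maps $\varphi_1,\dots,\varphi_n:A\to B$, the sequential $m$-contiguity distance $\mathrm{SD}_m(\varphi_1,\dots,\varphi_n)$ is the least integer $k\ge 0$ such that there is a covering of $A$ by subcomplexes $A_0,\dots,A_k$ with the property that, for each $j$ and for every simplicial map $\eta:P\to A_j$ from an $m$-dimensional simplicial complex $P$, the maps $\varphi_1\circ\eta,\dots,\varphi_n\circ\eta:P\to B$ are all in the same contiguity class; it is $\infty$ if there is no such covering. For $m\ge 1$, the $m$-simplicial LS category $\mathrm{scat}_m(A)$ is the least integer $k\ge 0$ such that $A$ has a cover by subcomplexes $A_0,\dots,A_k$ with the property that, for each $j$ and every simplicial map $\eta:P\to A_j$ from an $m$-dimensional simplicial complex $P$, one has $\iota_j\circ\eta\sim c_{a_0}\circ\eta$, where $\iota_j:A_j\to A$ is the inclusion and $c_{a_0}:A_j\to A$ is the constant map at a fixed vertex $a_0$ of $A$ (the choice of vertex is immaterial when $A$ is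 edge-path connected); it is $\infty$ if there is no such cover. $K^r$ denotes the $r$-fold categorical product: its vertices are $r$-tuples of vertices of $K$, and a finite nonempty set of such tuples is a simplex iff for each coordinate the set of its coordinate entries is a simplex of $K$. *)

(* Defs.v *)
From mathcomp Require Import all_boot.
From mathcomp Require Import boolp classical_sets functions cardinality.

Set Implicit Arguments.
Unset Strict Implicit.
Unset Printing Implicit Defensive.

Local Open Scope classical_set_scope.
Local Open Scope card_scope.

(* The carrier is exactly the set of vertices (see [simplex_vertex]); complexes
   may be infinite, and may be empty. *)
Record scomplex := SComplex {
  vertex :> Type;
  simplex : set (set vertex);
  simplex_finite : forall S, simplex S -> finite_set S;
  simplex_nonempty : forall S, simplex S -> S !=set0;
  simplex_face : forall S T, simplex S -> T `<=` S -> T !=set0 -> simplex T;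
  simplex_vertex : forall v, simplex [set v] }.
Arguments simplex : clear implicits.

Record smap (A B : scomplex) := SMap {
  smap_fun :> A -> B;
  smap_simplex : forall S, simplex A S -> simplex B (smap_fun @` S) }.

Lemma smap_comp_simplex (A B C : scomplex) (g : smap B C) (f : smap A B) S :
  simplex A S -> simplex C ((g \o f) @` S).
Proof. by rewrite -image_comp => AS; do 2!apply: smap_simplex. Qed.

Definition smap_comp (A B C : scomplex) (g : smap B C) (f : smap A B) :
  smap A C := SMap (@smap_comp_simplex A B C g f).

Lemma smap_const_simplex (A B : scomplex) (b : B) S :
  simplex A S -> simplex B ((fun=> b) @` S).
Proof.
move=> /simplex_nonempty[x Sx].
rewrite (_ : _ @` S = [set b]); first exact: simplex_vertex.
by apply/seteqP; split=> [_ [y _ <-]//|_ ->]; exists x.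
Qed.

Definition smap_const (A B : scomplex) (b : B) : smap A B :=
  SMap (@smap_const_simplex A B b).
Arguments smap_const : clear implicits.

Definition chain (T : Type) (R : T -> T -> Prop) (x y : T) : Prop :=
  exists (n : nat) (c : nat -> T),
    [/\ c 0 = x, c n = y & forall i, i < n -> R (c i) (c i.+1)].

(* A chain may stay at a vertex, since [set x; x] = [set x] is a simplex. *)
Definition edge_path_connected (A : scomplex) : Prop :=
  forall v w : A, chain (fun x y => simplex A [set x; y]) v w.

Definition contiguous (A B : scomplex) (f g : smap A B) : Prop :=
  forall S, simplex A S -> simplex B (f @` S `|` g @` S).

Definition same_contiguity_class (A B : scomplex) (f g : smap A B) : Prop :=
  chain (@contiguous A B) f g.

Definition has_dim (m : nat) (P : scomplex) : Prop :=
  (forall S, simplex P S -> S #<= `I_m.+1) /\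
  (exists2 S, simplex P S & S #= `I_m.+1).

(* A subcomplex may omit vertices of the ambient complex, and may be empty. *)
Record subcomplex (A : scomplex) := SubComplex {
  sub_simplex : set (set A);
  sub_simplexW : forall S, sub_simplex S -> simplex A S;
  sub_simplex_face : forall S T,
    sub_simplex S -> T `<=` S -> T !=set0 -> sub_simplex T }.

Section SubcomplexAsComplex.
Variables (A : scomplex) (C : subcomplex A).

Definition subvertex : Type := {v : A | sub_simplex C [set v]}.
Definition subvertex_simplex : set (set subvertex) :=
  [set S | sub_simplex C (sval @` S)].

Lemma subvertex_simplex_finite S : subvertex_simplex S -> finite_set S.
Proof.
move=> /sub_simplexW/simplex_finite fS.
have svI : injective (sval : subvertex -> A).
  by move=> [x px] [y py] /= xy; subst y; rewrite (Prop_irrelevance px py).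
have := @finite_preimage _ _ _ (sval : subvertex -> A) (in2W svI) fS.
by apply: sub_finite_set => x Sx; exists x.
Qed.

Lemma subvertex_simplex_nonempty S : subvertex_simplex S -> S !=set0.
Proof. by move=> /sub_simplexW/simplex_nonempty[_ [x Sx _]]; exists x. Qed.

Lemma subvertex_simplex_face S T :
  subvertex_simplex S -> T `<=` S -> T !=set0 -> subvertex_simplex T.
Proof.
move=> CS TS [x Tx]; apply: sub_simplex_face CS _ _.
  exact: image_subset.
by exists (sval x), x.
Qed.

Lemma subvertex_simplex_vertex v : subvertex_simplex [set v].
Proof. by rewrite /subvertex_simplex /= image_set1; case: v. Qed.

Definition scomplex_of_subcomplex : scomplex :=
  SComplex subvertex_simplex_finite subvertex_simplex_nonempty
    subvertex_simplex_face subvertex_simplex_vertex.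

Lemma smap_incl_simplex S :
  simplex scomplex_of_subcomplex S ->
  simplex A ((sval : scomplex_of_subcomplex -> A) @` S).
Proof. exact: sub_simplexW. Qed.

Definition smap_incl : smap scomplex_of_subcomplex A := SMap smap_incl_simplex.

End SubcomplexAsComplex.

Coercion scomplex_of_subcomplex : subcomplex >-> scomplex.

Definition covering (A : scomplex) (k : nat) (C : 'I_k.+1 -> subcomplex A) :
  Prop := forall S, simplex A S -> exists j, sub_simplex (C j) S.

(* The least element of [Q], with [None] standing for infinity. *)
Definition least (Q : nat -> Prop) : option nat :=
  if pselect (exists k, `[< Q k >]) is left exQ then Some (ex_minn exQ)
  else None.

Definition SD (m n : nat) (A B : scomplex) (phi : 'I_n -> smap A B) :
  option nat :=
  least (fun k => exists C : 'I_k.+1 -> subcomplex A, covering C /\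
    forall j (P : scomplex) (eta : smap P (C j)), has_dim m P ->
      forall a b : 'I_n,
        same_contiguity_class
          (smap_comp (smap_comp (phi a) (smap_incl (C j))) eta)
          (smap_comp (smap_comp (phi b) (smap_incl (C j))) eta)).

Definition scat (m : nat) (A : scomplex) (a0 : A) : option nat :=
  least (fun k => exists C : 'I_k.+1 -> subcomplex A, covering C /\
    forall j (P : scomplex) (eta : smap P (C j)), has_dim m P ->
      same_contiguity_class
        (smap_comp (smap_incl (C j)) eta)
        (smap_comp (smap_const (C j) A a0) eta)).

Section CategoricalPower.
Variables (K : scomplex) (r : nat).

Definition power_simplex : set (set (r.-tuple K)) :=
  [set S | [/\ finite_set S, S !=set0 &
     forall l : 'I_r, simplex K ((fun x => tnth x l) @` S)]].

Lemma power_simplex_finite S : power_simplex S -> finite_set S.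
Proof. by case. Qed.

Lemma power_simplex_nonempty S : power_simplex S -> S !=set0.
Proof. by case. Qed.

Lemma power_simplex_face S T :
  power_simplex S -> T `<=` S -> T !=set0 -> power_simplex T.
Proof.
move=> [fS _ KS] TS [x Tx]; split; first exact: sub_finite_set fS.
  by exists x.
move=> l; apply: simplex_face (KS l) _ _; first exact: image_subset.
by exists (tnth x l), x.
Qed.

Lemma power_simplex_vertex v : power_simplex [set v].
Proof.
split; [exact: finite_set1 | by exists v |].
by move=> l; rewrite image_set1; exact: simplex_vertex.
Qed.

Definition cpower : scomplex :=
  SComplex power_simplex_finite power_simplex_nonempty
    power_simplex_face power_simplex_vertex.

End CategoricalPower.

Section CoordinateInclusion.
Variables (K : scomplex) (v0 : K) (r s : nat) (i : 'I_r -> 'I_s).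

(* [i] is only used when strictly increasing, so that [l] is unique. *)
Definition coord_incl_fun (x : cpower K r) : cpower K s :=
  [tuple if [pick l | i l == k] is Some l then tnth x l else v0 | k < s].

Lemma coord_incl_simplex S :
  simplex (cpower K r) S -> simplex (cpower K s) (coord_incl_fun @` S).
Proof.
move=> [fS [x Sx] KS]; split; first exact: finite_image.
  by exists (coord_incl_fun x), x.
move=> k; rewrite image_comp.
have -> : (fun x => tnth x k) \o coord_incl_fun =
    fun x => if [pick l | i l == k] is Some l then tnth x l else v0.
  by apply/funext => y /=; rewrite tnth_mktuple.
case: pickP => [l _|_]; first exact: KS.
by apply: (@smap_const_simplex (cpower K r)); split=> //; exists x.
Qed.

Definition coord_incl : smap (cpower K r) (cpower K s) :=
  SMap coord_incl_simplex.

End CoordinateInclusion.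

Definition strictly_increasing (r s : nat) (i : 'I_r -> 'I_s) : Prop :=
  forall a b : 'I_r, a < b -> i a < i b.

(* Main.v *)
(** A simplicial map into a categorical power lies in the contiguity class of a
    constant map iff each of its coordinates does: the finitely many coordinate
    chains can be padded to a common length and run in parallel. Composing with
    a coordinate inclusion only permutes the coordinates and adds constant ones,
    so a map into [K^r] that is null becomes null in [K^s] under every
    inclusion. Conversely, for each coordinate [l] of [K^r], compare the
    inclusion into the first [r] factors of [K^s] with one that omits the factor
    [l] (possible as [r < s]): projecting to that factor links the [l]-th
    coordinate of the map to a constant. *)

Require Import Defs.
From mathcomp Require Import all_boot.
From mathcomp Require Import boolp classical_sets functions cardinality.

Set Implicit Arguments.
Unset Strict Implicit.
Unset Printing Implicit Defensive.

Local Open Scope classical_set_scope.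

(** * Finite chains of a relation *)

Lemma chain_refl (T : Type) (R : T -> T -> Prop) (x : T) : chain R x x.
Proof. by exists 0, (fun=> x). Qed.

Lemma chain_sym (T : Type) (R : T -> T -> Prop) (x y : T) :
  (forall u v, R u v -> R v u) -> chain R x y -> chain R y x.
Proof.
move=> Rsym [n [c [c0 cn Rc]]]; exists n, (fun t => c (n - t)).
split=> [||t tn]; rewrite ?subn0 ?subnn //; apply: Rsym.
by rewrite -(subnSK tn); apply: Rc; rewrite ltn_subrL (leq_ltn_trans _ tn).
Qed.

Lemma chain_trans (T : Type) (R : T -> T -> Prop) (x y z : T) :
  chain R x y -> chain R y z -> chain R x z.
Proof.
move=> [n [c [c0 cn Rc]]] [p [d [d0 dp Rd]]].
exists (n + p), (fun t => if t <= n then c t else d (t - n)); split=> //.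
(* The endpoint [n + p] is read from [c] only if [p = 0], and then [y = d 0 = d p = z]. *)
- case: leqP => [|_]; last by rewrite addKn.
  rewrite -{2}(addn0 n) leq_add2l leqn0 => /eqP p0.
  by rewrite -dp p0 addn0 cn d0.
- move=> t tnp; case: (ltngtP t n) => [/Rc//|nt|tn].
    by rewrite subSn 1?ltnW//; apply: Rd; rewrite ltn_subLR// ltnW.
  rewrite tn subSnn cn -d0; apply: Rd.
  by rewrite -(ltn_add2l n) addn0 -{1}tn.
Qed.

Lemma chain_map (T U : Type) (R : T -> T -> Prop) (Q : U -> U -> Prop)
    (h : T -> U) (x y : T) :
  (forall u v, R u v -> Q (h u) (h v)) -> chain R x y -> chain Q (h x) (h y).
Proof.
move=> RQ [n [c [c0 cn Rc]]]; exists n, (h \o c).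
by split=> [||t /Rc/RQ//] /=; rewrite ?c0 ?cn.
Qed.

(** Reflexivity lets a chain wait at its end, so that chains of different lengths can be run side by
    side. Length and chain form one pair so that a single use of [choice] selects both. *)
Lemma chain_pad (T : Type) (R : T -> T -> Prop) (x y : T) :
  (forall u, R u u) -> chain R x y ->
  exists nc : nat * (nat -> T), [/\ nc.2 0 = x,
    forall t, nc.1 <= t -> nc.2 t = y & forall t, R (nc.2 t) (nc.2 t.+1)].
Proof.
move=> Rxx [n [c [c0 cn Rc]]]; exists (n, fun t => c (minn t n)).
split=> /= [|t /minn_idPr ->//|t]; first by rewrite min0n.
case: (ltnP t n) => [tn|nt].
  by rewrite (minn_idPl tn); exact: Rc.
by rewrite (minn_idPr (leqW nt)).
Qed.

Lemma smap_ext (A B : scomplex) (f g : smap A B) : f =1 g -> f = g.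
Proof.
case: f g => [f pf] [g pg] /= /funext fg; subst g.
by rewrite (Prop_irrelevance pf pg).
Qed.

Section ContiguityClass.
Variables A B : scomplex.
Implicit Types f g h : smap A B.

Lemma contiguous_refl f : contiguous f f.
Proof. by move=> S AS; rewrite setUid; exact: smap_simplex. Qed.

Lemma contiguous_sym f g : contiguous f g -> contiguous g f.
Proof. by move=> fg S AS; rewrite setUC; exact: fg. Qed.

Lemma same_contiguity_class_sym f g :
  same_contiguity_class f g -> same_contiguity_class g f.
Proof. exact/chain_sym/contiguous_sym. Qed.

Lemma same_contiguity_class_trans g f h :
  same_contiguity_class f g -> same_contiguity_class g h ->
  same_contiguity_class f h.
Proof. exact: chain_trans. Qed.

Lemma contiguous_const (x y : B) :
  simplex B [set x; y] -> contiguous (smap_const A B x) (smap_const A B y).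
Proof.
move=> Bxy S /simplex_nonempty[z Sz]; apply: simplex_face Bxy _ _.
  by move=> w [[u _ <-]|[u _ <-]]; [left | right].
by exists x; left; exists z.
Qed.

(** Each edge of a path from [x] to [y] makes the constant maps at its two ends contiguous. *)
Lemma same_contiguity_class_const (x y : B) : edge_path_connected B ->
  same_contiguity_class (smap_const A B x) (smap_const A B y).
Proof. by move=> /(_ x y); apply: chain_map => u v; exact: contiguous_const. Qed.

End ContiguityClass.

Lemma same_contiguity_class_comp (A B C : scomplex) (h : smap B C)
    (f g : smap A B) : same_contiguity_class f g ->
  same_contiguity_class (smap_comp h f) (smap_comp h g).
Proof.
apply: (@chain_map _ _ _ _ (smap_comp h)) => u v uv S AS.
suff -> : smap_comp h u @` S `|` smap_comp h v @` S =
    h @` (u @` S `|` v @` S) by exact/smap_simplex/uv.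
by rewrite image_setU !image_comp.
Qed.

(** * Maps into a categorical power *)

Section Power.
Variables (K : scomplex) (r : nat).

Lemma proj_simplex (l : 'I_r) S :
  simplex (cpower K r) S -> simplex K ((fun x => tnth x l) @` S).
Proof. by case. Qed.

Definition smap_proj (l : 'I_r) : smap (cpower K r) K :=
  SMap (@proj_simplex l).

Variable P : scomplex.

Definition tuple_fun (F : 'I_r -> smap P K) (x : P) : cpower K r :=
  [tuple F l x | l < r].

Lemma proj_tuple_fun F l S :
  (fun x => tnth x l) @` (tuple_fun F @` S) = F l @` S.
Proof.
by rewrite image_comp; apply: eq_imagel => x _ /=; rewrite tnth_mktuple.
Qed.

Lemma tuple_fun_simplex F S :
  simplex P S -> simplex (cpower K r) (tuple_fun F @` S).
Proof.
move=> PS; split.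
- exact/finite_image/(simplex_finite PS).
- by have [x Sx] := simplex_nonempty PS; exists (tuple_fun F x), x.
- by move=> l; rewrite proj_tuple_fun; exact: smap_simplex.
Qed.

Definition smap_tuple (F : 'I_r -> smap P K) : smap P (cpower K r) :=
  SMap (@tuple_fun_simplex F).

Lemma contiguous_tuple (F G : 'I_r -> smap P K) :
  (forall l, contiguous (F l) (G l)) ->
  contiguous (smap_tuple F) (smap_tuple G).
Proof.
move=> FG S PS; have [fF [x Sx] _] := tuple_fun_simplex F PS.
have [fG _ _] := tuple_fun_simplex G PS; split.
- by rewrite finite_setU.
- by exists x; left.
- by move=> l; rewrite image_setU !proj_tuple_fun; exact: FG.
Qed.

Lemma smap_tuple_proj (f : smap P (cpower K r)) :
  smap_tuple (fun l => smap_comp (smap_proj l) f) = f.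
Proof. by apply: smap_ext => x; apply: eq_from_tnth => l; rewrite tnth_mktuple. Qed.

Lemma same_contiguity_class_proj (f g : smap P (cpower K r)) :
  (forall l, same_contiguity_class (smap_comp (smap_proj l) f)
                                   (smap_comp (smap_proj l) g)) ->
  same_contiguity_class f g.
Proof.
move=> fg; have [nc ncP] := choice (fun l => chain_pad (@contiguous_refl P K) (fg l)).
(* At the maximum of the lengths every padded coordinate chain has reached its end. *)
exists (\max_l (nc l).1), (fun t => smap_tuple (fun l => (nc l).2 t)).
split=> [||t _].
- rewrite -[RHS]smap_tuple_proj; congr smap_tuple.
  by apply/funext => l; have [] := ncP l.
- rewrite -[RHS]smap_tuple_proj; congr smap_tuple.
  by apply/funext => l; have [_ + _] := ncP l; apply; exact: leq_bigmax.
- by apply: contiguous_tuple => l; have [_ _] := ncP l.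
Qed.

(** Constant maps into [K] all lie in one class, so [a] and [v] may be chosen independently; below,
    [v] is the value [v0] that coordinate inclusions insert. *)
Lemma null_class_proj (f : smap P (cpower K r)) (a : cpower K r) (v : K) :
  edge_path_connected K ->
  same_contiguity_class f (smap_const P (cpower K r) a) <->
  forall l, same_contiguity_class (smap_comp (smap_proj l) f) (smap_const P K v).
Proof.
move=> Kconn.
have projC l : smap_comp (smap_proj l) (smap_const P (cpower K r) a) =
    smap_const P K (tnth a l) by exact: smap_ext.
split=> [fa l|fv].
  have := same_contiguity_class_comp (smap_proj l) fa; rewrite projC => h.
  exact/(same_contiguity_class_trans h)/same_contiguity_class_const.
apply: same_contiguity_class_proj => l; rewrite projC.
exact/(same_contiguity_class_trans (fv l))/same_contiguity_class_const.
Qed.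

End Power.

Lemma least_ext (Q Q' : nat -> Prop) :
  (forall k, Q k <-> Q' k) -> least Q = least Q'.
Proof. by move=> QQ'; congr least; apply/funext => k; apply/propext. Qed.

Arguments smap_proj {K r}.

(** * Null maps and coordinate inclusions *)

Section CoordInclClass.
Variables (K : scomplex) (Kconn : edge_path_connected K) (v0 : K).
Variables (r s : nat) (P : scomplex) (f : smap P (cpower K r)).

Lemma null_class_coord_incl (i : 'I_r -> 'I_s) (a : cpower K r)
    (b : cpower K s) :
  same_contiguity_class f (smap_const P _ a) ->
  same_contiguity_class (smap_comp (coord_incl v0 i) f) (smap_const P _ b).
Proof.
move=> /(null_class_proj f a v0 Kconn) fv.
apply/(null_class_proj _ b v0 Kconn) => k.
(* The [k]-th coordinate of the composite is a coordinate of [f] or constant at [v0], according to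
   the outcome of [pick]. *)
case E : [pick l | i l == k] => [l|].
  suff -> : smap_comp (smap_proj k) (smap_comp (coord_incl v0 i) f) =
            smap_comp (smap_proj l) f by exact: fv.
  by apply: smap_ext => x; rewrite /= tnth_mktuple E.
suff -> : smap_comp (smap_proj k) (smap_comp (coord_incl v0 i) f) =
          smap_const P K v0 by exact: chain_refl.
by apply: smap_ext => x; rewrite /= tnth_mktuple E.
Qed.

Lemma proj_coord_incl (i : 'I_r -> 'I_s) (l : 'I_r) : injective i ->
  smap_comp (smap_proj (i l)) (smap_comp (coord_incl v0 i) f) =
  smap_comp (smap_proj l) f.
Proof.
move=> injI; apply: smap_ext => x; rewrite /= tnth_mktuple.
by case: pickP => [l' /eqP/injI ->//|/(_ l)]; rewrite eqxx.
Qed.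

Lemma proj_coord_incl_notin (i : 'I_r -> 'I_s) (k : 'I_s) :
  (forall l, i l != k) ->
  smap_comp (smap_proj k) (smap_comp (coord_incl v0 i) f) = smap_const P K v0.
Proof.
move=> ik; apply: smap_ext => x; rewrite /= tnth_mktuple.
by case: pickP => // l; rewrite (negbTE (ik l)).
Qed.

Lemma null_class_of_coord_incl (a : cpower K r) : r < s ->
  (forall i j : 'I_r -> 'I_s, strictly_increasing i -> strictly_increasing j ->
     same_contiguity_class (smap_comp (coord_incl v0 i) f)
                           (smap_comp (coord_incl v0 j) f)) ->
  same_contiguity_class f (smap_const P _ a).
Proof.
move=> rs allIJ; apply/(null_class_proj f a v0 Kconn) => l.
pose i := widen_ord (ltnW rs).
(* Here [r < s] enters: once the index [i l] is removed, [s.-1] indices remain, enough for [r]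
   coordinates. [lift (i l)] enumerates them in increasing order. *)
have ls1 : r <= s.-1 by rewrite -ltnS (ltn_predK rs).
pose j (l' : 'I_r) := lift (i l) (widen_ord ls1 l').
have incI : strictly_increasing i by [].
have incJ : strictly_increasing j.
  by move=> x y xy; rewrite /= ltnNge leq_bump2 -ltnNge.
have := same_contiguity_class_comp (smap_proj (i l)) (allIJ i j incI incJ).
rewrite proj_coord_incl; last by move=> x y /(congr1 val) /= /val_inj.
by rewrite proj_coord_incl_notin// => l'; rewrite eq_sym neq_lift.
Qed.

End CoordInclClass.

Theorem theorem6p1 (m : nat) (hm : 1 <= m)
    (K : scomplex) (hK : edge_path_connected K) (v0 : K)
    (r s : nat) (hr : 1 <= r) (hrs : r < s)
    (I : 'I_('C(s, r)) -> smap (cpower K r) (cpower K s))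
    (hI : range I =
          [set f | exists2 i : 'I_r -> 'I_s,
                     strictly_increasing i & f = coord_incl v0 i])
    (a0 : cpower K r) :
  SD m I = scat m a0.
Proof.
apply: least_ext => k.
have compA (P : scomplex) (C : subcomplex (cpower K r)) (eta : smap P C)
      (h : smap (cpower K r) (cpower K s)) :
    smap_comp (smap_comp h (smap_incl C)) eta =
    smap_comp h (smap_comp (smap_incl C) eta) by exact: smap_ext.
have compC (P : scomplex) (C : subcomplex (cpower K r)) (eta : smap P C) :
    smap_comp (smap_const C _ a0) eta = smap_const P _ a0 by exact: smap_ext.
(* The same covering serves in both directions; only the condition on each [eta] has to be
   transferred. *)
split=> -[C [covC nullC]]; exists C; split=> // j P eta dimP.
  rewrite compC; apply: (@null_class_of_coord_incl _ hK v0 _ _ _ _ _ hrs) => i i' incI incI'.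
  have surjI u : strictly_increasing u -> exists a, I a = coord_incl v0 u.
    move=> incu; have : range I (coord_incl v0 u) by rewrite hI; exists u.
    by case=> a _; exists a.
  have [a <-] := surjI _ incI; have [b <-] := surjI _ incI'.
  by rewrite -!compA; exact: nullC.
have {}nullC := nullC j P eta dimP; rewrite compC in nullC.
(* Any two of the maps are compared through one common constant map, at the tuple with all entries
   [v0]. *)
have nullI a : same_contiguity_class
    (smap_comp (I a) (smap_comp (smap_incl (C j)) eta))
    (smap_const P (cpower K s) [tuple v0 | _ < s]).
  have : range I (I a) by exists a.
  by rewrite hI => -[i _ ->]; exact: null_class_coord_incl nullC.
move=> a b; rewrite !compA; apply: same_contiguity_class_trans (nullI a) _.
exact: same_contiguity_class_sym.
Qed.
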